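(* Let $m,n$ be positive integers and let $f:\mathbb{Z}_{\geq 0}\to\mathbb{Z}_{\geq 0}$ be an increasing function. Then $$\mathfrak{L}_{f,m}^n=\psi_n,$$ where $\psi_0=0$ and, for $i\geq 0$, $$\psi_{i+1}=\Psi_{f_i,m}\big(1,(f_i(1),0,\dots,0)\big)+\psi_i,\qquad f_i(x)=f(x+\psi_i).$$
   Context: ''Increasing'' means $f(i)\leq f(j)$ whenever $i\leq j$. Write $n=\{0,1,\dots,n-1\}$ and order $\mathbb{Z}_{\geq 0}^m\times n$ by: $(\tau,i)\leq(\eta,j)$ iff $i=j$ and $\tau\leq\eta$ in the product (coordinatewise) order of $\mathbb{Z}_{\geq 0}^m$. The degree of $(\tau,i)$ with $\tau=(\tau_1,\dots,\tau_m)$ is $\tau_1+\cdots+\tau_m$. An antichain sequence of $\mathbb{Z}_{\geq 0}^m\times n$ is a finite sequence $a_1,\dots,a_k$ with $a_i\nleq a_j$ for all $i\neq j$; its degree growth is bounded by $f$ if $\deg a_i\leq f(i)$ for all $1\leq i\leq k$. $\mathfrak{L}_{f,m}^n$ is the maximal length of an antichain sequence of $\mathbb{Z}_{\geq 0}^m\times n$ with degree growth bounded by $f$. For an increasing function $h:\mathbb{Z}_{\geq 0}\to\mathbb{Z}_{\geq 0}$, the function $\Psi_{h,m}=\Psi:\mathbb{Z}_{\geq 0}\times\mathbb{Z}_{\geq 0}^m\to\mathbb{Z}_{\geq 0}$ is defined recursively by $$\Psi(i,(0,\dots,0,u_m))=i,$$ $$\Psi(i-1,(u_1,\dots,u_r,0,\dots,0,u_m))=\Psi(i,(u_1,\dots,u_r-1,\,h(i)-h(i-1)+u_m+1,\,0,\dots,0))\quad\text{if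 } r<m-1,\ u_r>0,$$ $$\Psi(i-1,(u_1,\dots,u_{m-1},u_m))=\Psi(i,(u_1,\dots,u_{m-1}-1,\,h(i)-h(i-1)+u_m+1))\quad\text{if } u_{m-1}>0.$$ In the second line the entry $h(i)-h(i-1)+u_m+1$ is in position $r+1$. *)

(* Defs.v *)
From mathcomp Require Import all_boot zify.

Set Implicit Arguments.
Unset Strict Implicit.
Unset Printing Implicit Defensive.

(** * Antichain sequences of N^m x n *)

Definition vec_le m n (a b : m.-tuple nat * 'I_n) : bool :=
  (a.2 == b.2) && [forall l, tnth a.1 l <= tnth b.1 l].

Definition deg m n (a : m.-tuple nat * 'I_n) : nat :=
  \sum_(l < m) tnth a.1 l.

Definition antichain_sequence m n k (a : 'I_k -> m.-tuple nat * 'I_n) : Prop :=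
  forall i j : 'I_k, i != j -> ~~ vec_le (a i) (a j).

(* The members of a sequence are numbered from 1: [a i] is the (i+1)-st. *)
Definition degree_growth_bounded (f : nat -> nat) m n k
    (a : 'I_k -> m.-tuple nat * 'I_n) : Prop :=
  forall i : 'I_k, deg (a i) <= f i.+1.

Definition bounded_antichain_length (f : nat -> nat) m n k : Prop :=
  exists a : 'I_k -> m.-tuple nat * 'I_n,
    antichain_sequence a /\ degree_growth_bounded f a.

(* [max_antichain_length f m n L] says that the maximal length of a bounded
   antichain sequence exists and is equal to [L]. *)
Definition max_antichain_length (f : nat -> nat) m n L : Prop :=
  bounded_antichain_length f m n L /\
  forall k, bounded_antichain_length f m n k -> k <= L.

(** * The function Psi *)

(* A vector (u_1, ..., u_m) is a sequence of size m, so one function covers all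
   m at once.  [Psi] is defined by well-founded recursion; the recursive
   equations that characterize it on nonempty vectors are [Psi_zero],
   [Psi_inner] (r < m-1) and [Psi_last] (r = m-1) below, stated with i, i+1 where
   the usual form has i-1, i.  The subtraction [h i.+1 - h i] is truncated, which
   is harmless as [h] is increasing. *)

Definition init_zero (u : seq nat) : bool :=
  all (pred1 0) (take (size u).-1 u).

(* The largest r with 1 <= r <= m-1 and u_r > 0, when [init_zero u] fails. *)
Definition last_pos (u : seq nat) : nat :=
  (size u).-1 - find (predC1 0) (rev (take (size u).-1 u)).

(* (u_1, ..., u_r - 1, h(i+1) - h(i) + u_m + 1, 0, ..., 0), where r is
   [last_pos u]; for r = m-1 there are no trailing zeros. *)
Definition Psi_next (h : nat -> nat) (i : nat) (u : seq nat) : seq nat :=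
  let r := last_pos u in
  take r.-1 u ++ (nth 0 u r.-1).-1 :: h i.+1 - h i + last 0 u + 1
    :: nseq (size u - r.+1) 0.

(* The strict lexicographic order on vectors of the same size. *)
Definition lex_lt (v u : seq nat) : Prop :=
  exists s a b t t',
    [/\ v = s ++ a :: t, u = s ++ b :: t', a < b & size t = size t'].

Lemma lex_lt_wf : well_founded lex_lt.
Proof.
suff H k : forall u, size u = k -> Acc lex_lt u by move=> u; exact: (H (size u)).
elim: k => [|k IH] u su.
  constructor=> v [s [a [b [t [t' [_ def_u _ _]]]]]].
  by move: su; rewrite def_u size_cat /= addnS.
case: u su => [//|x u [su]].
elim/ltn_ind: x u su => x IHx u su.
have accu := IH u su.
elim: accu su => {}u _ IHu su; constructor=> v.
case=> -[|y s] [a [b [t [t' [-> /=]]]]].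
  by case=> xb def_u ab st; apply: IHx; [rewrite xb | rewrite st -def_u].
case=> <- def_u ab st; apply: IHu.
  by exists s, a, b, t, t'.
by rewrite -su def_u !size_cat /= st.
Qed.

Lemma init_zero_rcons u b : init_zero (rcons u b) = all (pred1 0) u.
Proof. by rewrite /init_zero size_rcons /= -cats1 take_size_cat. Qed.

Lemma last_posE s a k b :
  last_pos (s ++ a.+1 :: rcons (nseq k 0) b) = (size s).+1.
Proof.
rewrite -rcons_cons -rcons_cat /last_pos size_rcons /= -cats1 take_size_cat //.
rewrite rev_cat rev_cons -cats1 rev_nseq find_cat has_cat find_cat.
rewrite has_nseq /= andbF size_nseq /= addn0.
by rewrite size_cat /= size_nseq -addSnnS addnK.
Qed.

Lemma init_zeroPn u : ~~ init_zero u ->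
  exists s a k b, u = s ++ a.+1 :: rcons (nseq k 0) b.
Proof.
case/lastP: u => [//|u b]; rewrite init_zero_rcons.
elim/last_ind: u b => [//|u x IH] b; rewrite all_rcons /=.
case: x => [|x] /=; last first.
  by move=> _; exists u, x, 0, b; rewrite -!cats1 -catA.
move=> /(IH 0) [s [a [k [c]]]].
rewrite -rcons_cons -rcons_cat => /rcons_inj [-> _].
exists s, a, k.+1, b.
by rewrite -(addn1 k) nseqD cats1 !rcons_cat.
Qed.

Lemma Psi_nextE h i s a k b :
  Psi_next h i (s ++ a.+1 :: rcons (nseq k 0) b) =
  s ++ a :: h i.+1 - h i + b + 1 :: nseq k 0.
Proof.
rewrite /Psi_next last_posE /= take_size_cat // nth_cat ltnn subnn /=.
rewrite last_cat /= last_rcons; congr (_ ++ _ :: _ :: nseq _ _).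
by rewrite size_cat /= size_rcons size_nseq; lia.
Qed.

Lemma Psi_next_lt h i u : ~ init_zero u -> lex_lt (Psi_next h i u) u.
Proof.
move/negP/init_zeroPn=> [s [a [k [b ->]]]]; rewrite Psi_nextE.
exists s, a, a.+1, (h i.+1 - h i + b + 1 :: nseq k 0), (rcons (nseq k 0) b).
by split=> //=; rewrite size_rcons size_nseq.
Qed.

Fixpoint Psi_rec (h : nat -> nat) (i : nat) (u : seq nat) (acc : Acc lex_lt u)
    {struct acc} : nat :=
  match decP (@idP (init_zero u)) with
  | left _ => i
  | right nz => Psi_rec h i.+1 (Acc_inv acc (Psi_next_lt h i nz))
  end.

Definition Psi (h : nat -> nat) (i : nat) (u : seq nat) : nat :=
  Psi_rec h i (lex_lt_wf u).

Lemma Psi_rec_irr h i u (acc1 acc2 : Acc lex_lt u) :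
  Psi_rec h i acc1 = Psi_rec h i acc2.
Proof.
elim: (lex_lt_wf u) i acc1 acc2 => {}u _ IH i [acc1] [acc2] /=.
by case: decP => // nz; apply: IH; apply: Psi_next_lt.
Qed.

Lemma PsiE h i u :
  Psi h i u = if init_zero u then i else Psi h i.+1 (Psi_next h i u).
Proof.
rewrite {1}/Psi; case: (lex_lt_wf u) => acc /=.
case: decP => [-> //|nz]; rewrite (negbTE (introN idP nz)).
exact: Psi_rec_irr.
Qed.

Lemma Psi_zero h i k b : Psi h i (rcons (nseq k 0) b) = i.
Proof. by rewrite PsiE init_zero_rcons all_nseq /= orbT. Qed.

Lemma Psi_inner h i s a k b :
  Psi h i (s ++ [:: a.+1, 0 & rcons (nseq k 0) b]) =
  Psi h i.+1 (s ++ [:: a, h i.+1 - h i + b + 1 & rcons (nseq k 0) 0]).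
Proof.
rewrite PsiE -[0 :: rcons _ b]/(rcons (nseq k.+1 0) b) Psi_nextE.
rewrite -rcons_cons -rcons_cat init_zero_rcons all_cat /= andbF.
suff -> : rcons (nseq k 0) 0 = 0 :: nseq k 0 by [].
by rewrite -[RHS]/(nseq k.+1 0) -(addn1 k) nseqD cats1.
Qed.

Lemma Psi_last h i s a b :
  Psi h i (s ++ [:: a.+1; b]) = Psi h i.+1 (s ++ [:: a; h i.+1 - h i + b + 1]).
Proof.
rewrite PsiE (Psi_nextE h i s a 0 b).
rewrite -[[:: _; b]]/(rcons [:: a.+1] b) -rcons_cat init_zero_rcons all_cat.
by rewrite /= andbF.
Qed.

(** * The sequence psi_0, psi_1, ... *)

Fixpoint psi (f : nat -> nat) (m i : nat) : nat :=
  if i is j.+1 then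
    let fj := fun x => f (x + psi f m j) in
    Psi fj 1 (fj 1 :: nseq m.-1 0) + psi f m j
  else 0.

(* Main.v *)
Require Import Defs.
From mathcomp Require Import all_boot all_order zify.

(** Both sides are compared with a third quantity: the maximal length of a
    sequence of monomials that decreases strictly in the lexicographic order (the
    component being compared first) and whose [i]-th member is a monomial of
    degree [f i].

    Such a sequence is an antichain sequence ([antichain_lower]): a later monomial
    has larger or equal degree and is lexicographically smaller, so neither of the
    two divides the other.

    Conversely, an antichain sequence yields such a sequence of the same length
    ([chain_of_antichain]). Sort it by degree, and let [J_i] be the set of
    multiples, in the degree of its [i]-th member, of its first [i] members. Each
    new member adds at least one element to the multiples of the previous ones.
    By Macaulay's theorem ([macaulay]), sets of multiples grow with the degree at
    least as fast as initial segments of the lexicographic order do. Hence there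
    is always a next monomial, in lexicographic order and in the degree of the
    next member, that can be added to the chain; a power of the last variable
    then raises its degree to [f i].

    The longest chains are greedy: take at each step the largest monomial of the
    prescribed degree below the previous one. In one component this is exactly the
    recursion that defines [Psi] ([Psi_next_max]), and a component is used up
    before the next one is entered, after which the same happens with the function
    [f] shifted by the number of steps already made: this is the recursion that
    defines [psi] ([psi_upper], [psi_attained]).

    Macaulay's theorem is proved directly for several components, by induction on
    the number of variables. A set of monomials is first compressed, exchanging the
    last variable with each other variable in turn, until it is stable
    ([stabilise]); for stable sets, slicing by the degree in the last variable
    reduces the statement to one variable fewer. *)

Set Implicit Arguments.
Unset Strict Implicit.
Unset Printing Implicit Defensive.

Import Order.Theory.

(** * Counting the elements above a given one *)

Lemma count_ltn (T : eqType) (a b : pred T) (X : seq T) y :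
  subpred a b -> y \in X -> b y -> ~~ a y -> count a X < count b X.
Proof.
move=> sab yX by_ nay; have /permP pX := perm_to_rem yX.
by rewrite !pX /= by_ (negbTE nay) ltnS sub_count.
Qed.

Lemma sub_in_count (T : eqType) (a b : pred T) (X : seq T) :
  {in X, forall x, a x -> b x} -> count a X <= count b X.
Proof.
elim: X => //= x X IH sab; apply: leq_add.
  by case: (a x) (sab x (mem_head x X)) => // ->.
by apply: IH => y yX; apply: sab; rewrite inE yX orbT.
Qed.

(** The number of elements of [X] above [x] is strictly decreasing in [x], so it
    takes [size X] different values below [size X]: it takes all of them. *)
Lemma rank_surj (T : eqType) (lt : rel T) (X : seq T) t :
  irreflexive lt -> transitive lt ->
  {in X &, forall x y, x != y -> lt x y || lt y x} -> uniq X -> t < size X ->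
  exists2 x, x \in X & count (lt x) X = t.
Proof.
move=> irr tr tot uX ltX.
pose ranks := [seq count (lt x) X | x <- X].
have rank_lt x y : x \in X -> y \in X -> lt x y ->
    count (lt y) X < count (lt x) X.
  move=> xX yX xy; apply: (@count_ltn _ _ _ _ y) => //; last by rewrite irr.
  by move=> z; apply: tr.
have u_ranks : uniq ranks.
  rewrite map_inj_in_uniq // => x y xX yX eq_xy; apply/eqP.
  have [//|nxy] := eqVneq x y.
  by case/orP: (tot _ _ xX yX nxy) => /rank_lt; rewrite eq_xy ltnn => ->.
have sub_ranks : {subset ranks <= iota 0 (size X)}.
  move=> _ /mapP[x xX ->]; rewrite mem_iota /= add0n -(count_predT X).
  by apply: (@count_ltn _ _ _ _ x) => //; rewrite irr.
have [|_ /(_ t)] := uniq_min_size u_ranks sub_ranks.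
  by rewrite size_iota size_map.
by rewrite mem_iota /= add0n ltX => /mapP[x xX ->]; exists x.
Qed.

(** * The lexicographic order on sequences *)

Definition lexlt (s t : seq nat) : bool := ((s : seqlexi nat) < t)%O.

Lemma lexltxx : irreflexive lexlt. Proof. by move=> s; rewrite /lexlt ltxx. Qed.
Lemma lexlt_trans : transitive lexlt.
Proof. by move=> t s u; apply: (@lt_trans _ (seqlexi nat)). Qed.
Lemma lexlt_total s t : s != t -> lexlt s t || lexlt t s.
Proof. exact: (@lt_total _ (seqlexi nat)). Qed.

Lemma lexlt_cons x s y t :
  lexlt (x :: s) (y :: t) = (x < y) || (x == y) && lexlt s t.
Proof.
rewrite /lexlt ltxi_cons !leEnat.
by case: (ltngtP x y) => //= ->.
Qed.

Lemma lexlt_rcons s x t y : size s = size t ->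
  lexlt (rcons s x) (rcons t y) = lexlt s t || (s == t) && (x < y).
Proof.
elim: s t => [|a s IH] [|b t] //= => [_|[/IH e]].
  by rewrite lexlt_cons lexltxx andbF orbF.
by rewrite !lexlt_cons e eqseq_cons andb_orr orbA andbA.
Qed.

(** * Monomials of a free module *)

(** In a monomial the head is the number of the component, not an exponent. *)
Definition wt (u : seq nat) := sumn (behead u).

(** A monomial of degree [d] in [k.+1] variables, in one of [n] components, is
    written [c :: e] with [c] its component and [e] its first [k] exponents: the
    last exponent is [d - wt (c :: e)]. In this encoding multiplication by the
    last variable is the identity, the sets [monos n k d] increase with [d], and
    the lexicographic order does not depend on [d]. The recursion lists the
    monomials by the degree [e] in all variables but the last. *)
Fixpoint monos n k d : seq (seq nat) :=
  if k is k'.+1 then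
    flatten
      [seq [seq rcons w (e - wt w) | w <- monos n k' e] | e <- iota 0 d.+1]
  else [seq [:: c] | c <- iota 0 n].

Arguments monos : simpl never.

Lemma monosS n k d : monos n k.+1 d =
  flatten [seq [seq rcons w (e - wt w) | w <- monos n k e] | e <- iota 0 d.+1].
Proof. by []. Qed.

Lemma wt_rcons w t : 0 < size w -> wt (rcons w t) = wt w + t.
Proof. by case: w => // x w _; rewrite /wt /= sumn_rcons. Qed.

Lemma head_rcons (w : seq nat) t : 0 < size w -> head 0 (rcons w t) = head 0 w.
Proof. by case: w. Qed.

Lemma mem_monos n k d u :
  (u \in monos n k d) = [&& size u == k.+1, head 0 u < n & wt u <= d].
Proof.
elim: k d u => [|k IH] d u.
  apply/mapP/and3P => [[c] | []].
    by rewrite mem_iota => /andP[_ cn] ->.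
  by case: u => [|c []] // _ /= cn _; exists c; rewrite ?mem_iota.
rewrite monosS; apply/flatten_mapP/and3P => [[e] | []].
  rewrite mem_iota => /andP[_ ed] /mapP[w].
  rewrite IH => /and3P[/eqP sw hw dw] ->.
  rewrite size_rcons sw head_rcons ?sw // wt_rcons ?sw //.
  by split => //; lia.
case/lastP: u => [|w t]; rewrite ?size_rcons // eqSS => /eqP sw.
rewrite head_rcons ?sw // wt_rcons ?sw // => hw dw.
exists (wt w + t); first by rewrite mem_iota; lia.
apply/mapP; exists w; first by rewrite IH sw eqxx hw leq_addr.
by rewrite addKn.
Qed.

Lemma monosSS n k d : monos n k.+1 d.+1 =
  monos n k.+1 d ++ [seq rcons w (d.+1 - wt w) | w <- monos n k d.+1].
Proof.
rewrite !monosS -[in LHS](addn1 d.+1) iotaD map_cat flatten_cat.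
by rewrite /= cats0.
Qed.

Lemma monos_uniq n k d : uniq (monos n k d).
Proof.
elim: k d => [|k IH] d.
  by rewrite map_inj_uniq ?iota_uniq // => x y; case.
have layer e : uniq [seq rcons w (e - wt w) | w <- monos n k e].
  by rewrite map_inj_uniq // => x y; case/rcons_inj.
elim: d => [|d IHd]; first by rewrite monosS /= cats0.
rewrite monosSS cat_uniq IHd layer andbT -all_predC; apply/allP => u /mapP[w].
rewrite mem_monos => /and3P[/eqP sw _ dw] -> /=.
by rewrite mem_monos wt_rcons ?sw // subnKC // ltnn !andbF.
Qed.

(** The threshold [p] need not be one of the monomials that are counted, which
    lets one [p] serve for several degrees. *)
Definition rank n k d p := count (lexlt p) (monos n k d).

(** * Compression *)

(** [W], in degree [d.+1], contains the product of each monomial of [U], in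
    degree [d], by each variable; [U] itself is its product by the last one. *)
Definition covers k (U W : seq (seq nat)) : Prop :=
  {subset U <= W} /\
  forall u i, u \in U -> i < k -> incr_nth u i.+1 \in W.

Lemma sumn_incr_nth s i : sumn (incr_nth s i) = (sumn s).+1.
Proof.
elim: s i => [|x s IH] [|i] //=; last by rewrite IH addnS.
by rewrite sumn_ncons /= mul0n.
Qed.

Lemma wt_incr u i : 0 < size u -> wt (incr_nth u i.+1) = (wt u).+1.
Proof. by case: u => // c u _; rewrite /wt /= sumn_incr_nth. Qed.

Lemma incr_nthE s i : incr_nth s i = set_nth 0 s i (nth 0 s i).+1.
Proof. by elim: s i => [|x s IH] [|i] //=; rewrite ?IH ?nth_nil. Qed.

Lemma set_nth_id (s : seq nat) i : i < size s -> set_nth 0 s i (nth 0 s i) = s.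
Proof. by elim: s i => [|x s IH] [|i] //= /IH ->. Qed.

Lemma nth_le_wt u j : nth 0 u j.+1 <= wt u.
Proof.
case: u => // c u; rewrite /wt /=.
elim: u j => [|x u IH] [|j] //=; first exact: leq_addr.
exact: leq_trans (IH j) (leq_addl _ _).
Qed.

Lemma wt_set_nth u j x : 0 < size u ->
  wt (set_nth 0 u j.+1 x) + nth 0 u j.+1 = wt u + x.
Proof.
case: u => // c u _; rewrite /wt /= sumn_set_nth0 subnK //.
apply: leq_trans (leq_addr _ _).
exact: (nth_le_wt (c :: u)).
Qed.

Section Compression.

Variables (n k j : nat).
Hypothesis jk : j < k.

(** The lines below are the sets of monomials of one degree that differ only by
    an exchange between the variable [j] and the last variable; [base] is a name
    for the line through [u]. *)
Definition base u := set_nth 0 u j.+1 0.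
Definition line X u := [seq w <- X | base w == base u].
Definition above X u := count (fun w => nth 0 u j.+1 < nth 0 w j.+1) (line X u).

(** Compression: on each line, the elements of [X] are moved as far as possible
    from the last variable, in the same order. The element that has [a] others
    before it gets [a] as its last exponent. *)
Definition push d X u :=
  set_nth 0 u j.+1 (nth 0 u j.+1 + (d - wt u) - above X u).

Lemma base_set u x : base (set_nth 0 u j.+1 x) = base u.
Proof. by rewrite /base set_set_nth eqxx. Qed.

Lemma set_base u x : set_nth 0 (base u) j.+1 x = set_nth 0 u j.+1 x.
Proof. by rewrite /base set_set_nth eqxx. Qed.

Lemma base_eq u w : size w = k.+1 -> base w = base u ->
  w = set_nth 0 u j.+1 (nth 0 w j.+1).
Proof.
by move=> sw e; rewrite -set_base -e set_base set_nth_id ?sw.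
Qed.

Lemma base_inj u w : size u = k.+1 -> size w = k.+1 -> base w = base u ->
  nth 0 w j.+1 = nth 0 u j.+1 -> w = u.
Proof.
by move=> su sw e en; rewrite (base_eq sw e) en set_nth_id ?su.
Qed.

Lemma base_incr u : base (incr_nth u j.+1) = base u.
Proof. by rewrite incr_nthE base_set. Qed.

Lemma base_wt u w : 0 < size u -> 0 < size w -> base w = base u ->
  wt w + nth 0 u j.+1 = wt u + nth 0 w j.+1.
Proof.
move=> su sw e; have := wt_set_nth j 0 su; have := wt_set_nth j 0 sw.
by rewrite -/(base u) -/(base w) e; lia.
Qed.

Lemma line_base X u w : base w = base u -> line X w = line X u.
Proof. by rewrite /line => ->. Qed.

Section Level.

Variables (d : nat) (X : seq (seq nat)).
Hypotheses (uX : uniq X) (XT : {subset X <= monos n k d}).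

Let size_X u : u \in X -> size u = k.+1.
Proof. by move/XT; rewrite mem_monos => /and3P[/eqP]. Qed.
Let wt_X u : u \in X -> wt u <= d.
Proof. by move/XT; rewrite mem_monos => /and3P[]. Qed.

Lemma mem_line u w : (w \in line X u) = (base w == base u) && (w \in X).
Proof. by rewrite mem_filter. Qed.

Lemma above_lt u : u \in X -> above X u < size (line X u).
Proof.
move=> xu; rewrite -count_predT; apply: (@count_ltn _ _ _ _ u) => //.
  by rewrite mem_line eqxx.
by rewrite ltnn.
Qed.

Lemma above_surj u t : t < size (line X u) ->
  exists2 w, w \in line X u & above X w = t.
Proof.
move=> lt_t.
pose lt (x y : seq nat) := nth 0 x j.+1 < nth 0 y j.+1.
have [||||w wl <-] := @rank_surj _ lt (line X u) t _ _ _ _ lt_t.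
- by move=> x; rewrite /lt ltnn.
- by move=> y x z; apply: ltn_trans.
- move=> x y; rewrite !mem_line => /andP[/eqP bx xX] /andP[/eqP by_ yX].
  apply: contraR; rewrite /lt negb_or -!leqNgt => xy; apply/eqP.
  by apply: base_inj; rewrite ?size_X ?bx ?by_ //; lia.
- exact: filter_uniq.
exists w => //; move: wl; rewrite mem_line => /andP[/eqP bw _].
by rewrite /above (line_base _ bw).
Qed.

(** The elements above [u] on its line have distinct exponents in the variable
    [j], at most [d - wt u] more than that of [u]. *)
Lemma above_le_gap u e : u \in X ->
    {in line X u, forall w, nth 0 u j.+1 < nth 0 w j.+1 ->
                            nth 0 u j.+1 + e < nth 0 w j.+1} ->
  above X u <= d - wt u - e.
Proof.
move=> xu gap; rewrite /above -size_filter -(size_map (fun w => nth 0 w j.+1)).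
rewrite -[leqRHS](size_iota (nth 0 u j.+1 + e).+1); apply: uniq_leq_size.
  rewrite map_inj_in_uniq ?filter_uniq // => x y.
  rewrite !mem_filter => /and3P[_ /eqP bx xX] /and3P[_ /eqP by_ yX] eq_xy.
  by apply: base_inj; rewrite ?size_X ?bx ?by_.
move=> _ /mapP[w + ->]; rewrite mem_filter => /andP[lt_w wl].
have lt_e := gap w wl lt_w; move: wl; rewrite mem_line => /andP[/eqP bw xw].
have := base_wt _ _ bw; rewrite !size_X // => /(_ isT isT).
have := wt_X xw; rewrite mem_iota; lia.
Qed.

Lemma above_le u : u \in X -> above X u <= d - wt u.
Proof.
by move=> xu; rewrite -[leqRHS]subn0 above_le_gap // => w; rewrite addn0.
Qed.

Lemma above_le1 u : u \in X -> incr_nth u j.+1 \notin X ->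
  above X u <= d - wt u - 1.
Proof.
move=> xu nxu; apply: above_le_gap => // w; rewrite mem_line addn1.
case/andP=> /eqP bw xw; rewrite leq_eqVlt => /orP[/eqP eq_w|//].
case/negP: nxu; rewrite incr_nthE eq_w -(base_eq _ bw) // size_X //.
Qed.

Lemma base_push u : base (push d X u) = base u.
Proof. exact: base_set. Qed.

Lemma wt_push u : u \in X -> wt (push d X u) = d - above X u.
Proof.
move=> xu; have := above_le xu; have := wt_X xu.
have := wt_set_nth j (nth 0 u j.+1 + (d - wt u) - above X u).
by move=> /(_ u); rewrite size_X // => /(_ isT); rewrite -/(push d X u); lia.
Qed.

Lemma push_monos u : u \in X -> push d X u \in monos n k d.
Proof.
move=> xu; have := XT xu; rewrite !mem_monos wt_push // leq_subr andbT.
case/and3P=> /eqP su + _; rewrite size_set_nth su (maxn_idPr _) //.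
by rewrite eqxx; case: u {xu} su.
Qed.

Lemma push_inj : {in X &, injective (push d X)}.
Proof.
have above_anti u v : u \in X -> v \in X -> base u = base v ->
    nth 0 u j.+1 < nth 0 v j.+1 -> above X v < above X u.
  move=> xu xv b lt_uv; rewrite /above (line_base _ b).
  apply: (@count_ltn _ _ _ _ v) => //; last by rewrite ltnn.
    by move=> w /=; apply: ltn_trans.
  by rewrite mem_line eqxx.
move=> u v xu xv e.
have b : base u = base v by rewrite -(base_push u) e base_push.
have ea : above X u = above X v.
  have := congr1 wt e; rewrite !wt_push //.
  have := above_le xu; have := above_le xv; lia.
apply: base_inj; rewrite ?size_X //.
have [lt|lt|//] := ltngtP (nth 0 u j.+1) (nth 0 v j.+1).
  by have := above_anti _ _ xu xv b lt; rewrite ea ltnn.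
by have := above_anti _ _ xv xu (esym b) lt; rewrite ea ltnn.
Qed.

(** The compressed set is thus an initial segment of each line: membership is
    decided by counting, without exhibiting the element that was moved. *)
Lemma mem_push v : v \in monos n k d -> d - wt v < size (line X v) ->
  v \in [seq push d X u | u <- X].
Proof.
move=> vT /above_surj[w]; rewrite mem_line => /andP[/eqP bw xw] aw.
apply/mapP; exists w => //.
have := vT; rewrite mem_monos => /and3P[/eqP sv _ dv].
have := push_monos xw; rewrite mem_monos => /and3P[/eqP sp _ _].
apply: base_inj; rewrite ?base_push //.
have := base_wt _ _ (etrans (base_push w) bw).
rewrite sp sv wt_push // => /(_ isT isT); lia.
Qed.

End Level.

End Compression.

Lemma incr_nth_injl i s t : size s = size t ->
  incr_nth s i = incr_nth t i -> s = t.
Proof.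
move=> sst e; apply: (@eq_from_nth _ 0) => // l _.
by have := congr1 (nth 0 ^~ l) e; rewrite !nth_incr_nth => /addnI.
Qed.

Lemma base_incr_neq j l u : l != j ->
  base j (incr_nth u l.+1) = incr_nth (base j u) l.+1.
Proof.
move=> lj; rewrite !incr_nthE /base set_set_nth eqSS (negbTE lj).
by rewrite nth_set_nth /= eqSS (negbTE lj).
Qed.

Lemma monos_incr n k d u i : u \in monos n k d -> i < k ->
  incr_nth u i.+1 \in monos n k d.+1.
Proof.
rewrite !mem_monos => /and3P[/eqP su hu du] ik.
rewrite wt_incr ?su // ltnS du andbT size_incr_nth su ltnS ik eqxx.
by case: u hu {su du}.
Qed.

Lemma monos_widen n k d d' : d <= d' -> {subset monos n k d <= monos n k d'}.
Proof.
by move=> dd u; rewrite !mem_monos => /and3P[-> -> /leq_trans->].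
Qed.

Definition shadow_pair n k d (U W : seq (seq nat)) : Prop :=
  [/\ uniq U, uniq W, {subset U <= monos n k d},
      {subset W <= monos n k d.+1} & covers k U W].

Section CompressPair.

Variables (n k d j : nat) (U W : seq (seq nat)).
Hypotheses (jk : j < k) (UW : shadow_pair n k d U W).

Let uU : uniq U. Proof. by case: UW. Qed.
Let uW : uniq W. Proof. by case: UW. Qed.
Let UT : {subset U <= monos n k d}. Proof. by case: UW. Qed.
Let WT : {subset W <= monos n k d.+1}. Proof. by case: UW. Qed.
Let UsubW : {subset U <= W}. Proof. by case: UW => _ _ _ _ []. Qed.
Let incrW u i : u \in U -> i < k -> incr_nth u i.+1 \in W.
Proof. by case: UW => _ _ _ _ [_]; apply. Qed.

(** On a line, multiplication by the two variables of the line produces at least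
    one more element: the first element of [U] times the variable [j]. *)
Lemma line_lt u : u \in U -> size (line j U u) < size (line j W u).
Proof.
move=> xu; have := above_lt j xu; move/(leq_ltn_trans (leq0n _)) => pos.
have [w wl w_top] := above_surj jk uU UT pos.
move: (wl); rewrite mem_line => /andP[/eqP bw wU].
apply: (@uniq_leq_size _ (incr_nth w j.+1 :: line j U u)).
  rewrite /= filter_uniq // andbT; apply/negP => w'l.
  move/eqP: w_top; rewrite /above eqn0Ngt -has_count (line_base _ bw).
  case/hasP; exists (incr_nth w j.+1) => //.
  by rewrite nth_incr_nth eqxx.
move=> v; rewrite inE => /orP[/eqP->|].
  by rewrite mem_line base_incr bw eqxx incrW.
by rewrite !mem_line => /andP[-> /UsubW].
Qed.

Lemma line_incr u l : l < k -> l != j ->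
  size (line j U u) <= size (line j W (incr_nth u l.+1)).
Proof.
move=> lk lj; rewrite -(size_map (fun w => incr_nth w l.+1)).
apply: uniq_leq_size.
  rewrite map_inj_in_uniq ?filter_uniq // => x y.
  rewrite !mem_line => /andP[_ /UT xT] /andP[_ /UT yT].
  apply: incr_nth_injl; move: xT yT; rewrite !mem_monos.
  by move=> /and3P[/eqP-> _ _] /and3P[/eqP-> _ _].
move=> _ /mapP[w + ->]; rewrite !mem_line => /andP[/eqP bw wU].
by rewrite !base_incr_neq // bw eqxx incrW.
Qed.

(** Compression does not enlarge the shadow: on each line the compressed sets
    are initial segments, so that only their cardinals matter, and these are
    compared by [line_lt] and [line_incr]. *)
Lemma compress_pair :
  shadow_pair n k d [seq push j d U u | u <- U] [seq push j d.+1 W w | w <- W].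
Proof.
have pushT u := push_monos jk uU UT (u := u).
split.
- by rewrite map_inj_in_uniq //; apply: push_inj UT.
- by rewrite map_inj_in_uniq //; apply: push_inj WT.
- by move=> _ /mapP[u xu ->]; apply: pushT.
- by move=> _ /mapP[u xu ->]; apply: push_monos WT _ xu.
have room u : u \in U -> let v := push j d U u in
    [/\ v \in monos n k d, wt v <= d, d - wt v < size (line j U v)
      & size (line j U v) < size (line j W v)].
  move=> xu /=; have vT := pushT _ xu.
  have bv := base_push j d U u.
  split => //; first by move: vT; rewrite mem_monos => /and3P[].
    rewrite (line_base _ bv) (wt_push jk uU UT) // subKn ?above_lt //.
    exact: leq_trans (above_le jk uU UT xu) (leq_subr _ _).
  by rewrite !(line_base _ bv) line_lt.
split.
  move=> _ /mapP[u xu ->]; have [vT dv rv lv] := room u xu.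
  apply: (mem_push jk uW WT); first exact: (monos_widen (leqnSn d)).
  by rewrite subSn // (leq_ltn_trans rv).
move=> _ l /mapP[u xu ->] lk; have [vT dv rv lv] := room u xu.
set v := push j d U u in vT dv rv lv *.
apply: (mem_push jk uW WT); first exact: monos_incr.
have sv : 0 < size v by move: vT; rewrite mem_monos => /and3P[/eqP->].
rewrite wt_incr // subSS.
have [->|lj] := eqVneq l j; last exact: leq_trans rv (line_incr _ lk lj).
by rewrite (line_base _ (base_incr j v)); apply: ltn_trans rv lv.
Qed.

End CompressPair.

(** * Stable sets *)

(** A set is stable when replacing a factor equal to the last variable by any
    other variable does not leave it. *)
Definition stable k d (U : seq (seq nat)) : bool :=
  all (fun u => (wt u < d) ==>
         all (fun i => incr_nth u i.+1 \in U) (iota 0 k)) U.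

Lemma stableP k d U u i : stable k d U -> u \in U -> wt u < d -> i < k ->
  incr_nth u i.+1 \in U.
Proof.
move=> /allP st uU du ik; move/implyP: (st u uU) => /(_ du) /allP; apply.
by rewrite mem_iota.
Qed.

(** As long as [U] is not stable, compressing it along a variable for which
    stability fails decreases the sum of the last exponents. *)
Lemma stabilise n k d U W : shadow_pair n k d U W ->
  exists U' W', [/\ shadow_pair n k d U' W', stable k d U',
                    size U' = size U & size W' = size W].
Proof.
have [N] := ubnP (\sum_(u <- U) (d - wt u)).
elim: N U W => // N IH U W; rewrite ltnS => leN UW.
have [st|] := boolP (stable k d U); first by exists U, W.
case/allPn=> u uU; rewrite negb_imply => /andP[du /allPn[j]].
rewrite mem_iota add0n => /andP[_ jk] nU.
have [uniqU _ UT _ _] := UW.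
have UW' := compress_pair jk UW.
have [|U' [W' [? ? eU eW]]] := IH _ _ _ UW'; last first.
  by exists U', W'; split; rewrite ?eU ?eW ?size_map.
apply: leq_trans leN; rewrite big_map.
have -> : \sum_(w <- U) (d - wt (push j d U w)) = \sum_(w <- U) above j U w.
  apply: eq_big_seq => w wU; rewrite (wt_push jk uniqU UT) // subKn //.
  exact: leq_trans (above_le jk uniqU UT wU) (leq_subr _ _).
rewrite !(big_rem u uU) /= -addSn leq_add //.
  by have := above_le1 jk uniqU UT uU nU; lia.
rewrite big_seq [leqRHS]big_seq; apply: leq_sum => w /mem_rem wU.
by have := above_le jk uniqU UT wU.
Qed.

(** * Macaulay's theorem *)

(** Where the degree [e] in all variables but the last is fixed, the last
    exponent stored is determined by the others and can be dropped. *)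
Definition slice k e (X : seq (seq nat)) :=
  [seq take k.+1 u | u <- X & wt u == e].

Lemma mem_slice n k d e X w : {subset X <= monos n k.+1 d} ->
  (w \in slice k e X) = (w \in monos n k e) && (rcons w (e - wt w) \in X).
Proof.
move=> XT; apply/mapP/andP => [[u + ->]|[]].
  rewrite mem_filter => /andP[/eqP <- xu]; move: (xu) => /XT.
  rewrite mem_monos; case/lastP: u xu => [|u t] // xu.
  rewrite size_rcons eqSS => /and3P[/eqP su hu du].
  rewrite -cats1 take_size_cat // cats1 mem_monos su eqxx.
  rewrite -(head_rcons t) ?su // hu wt_rcons ?su //.
  by rewrite leq_addr addKn.
rewrite mem_monos => /and3P[/eqP sw _ dw] xw.
exists (rcons w (e - wt w)).
  by rewrite mem_filter xw wt_rcons ?sw // subnKC // eqxx.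
by rewrite -cats1 take_size_cat.
Qed.

Lemma slice_uniq n k d e X :
  {subset X <= monos n k.+1 d} -> uniq X -> uniq (slice k e X).
Proof.
move=> XT uX; rewrite map_inj_in_uniq ?filter_uniq // => u v.
rewrite !mem_filter => /andP[/eqP eu /XT +] /andP[/eqP ev /XT].
rewrite !mem_monos.
case/lastP: u eu => [|u s]; case/lastP: v ev => [|v t] //.
rewrite !size_rcons !eqSS => + + /andP[/eqP su _] /andP[/eqP sv _].
rewrite -!cats1 !take_size_cat // !cats1 !wt_rcons ?su ?sv // => <- + e_uv.
by rewrite e_uv => /addnI->.
Qed.

Lemma incr_nth_rcons_last s x : incr_nth (rcons s x) (size s) = rcons s x.+1.
Proof. by elim: s => //= a s ->. Qed.

Lemma incr_nth_rcons s x i :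
  i < size s -> incr_nth (rcons s x) i = rcons (incr_nth s i) x.
Proof. by elim: s i => [|a s IH] [|i] //= /IH ->. Qed.

(** For [X] a shadow of [U], or for [X] equal to [U] when [U] is stable, the
    slices of degrees [e] and [e.+1] form a pair with one variable fewer. *)
Lemma slice_pair n k dU dX e U X : uniq U -> uniq X ->
  {subset U <= monos n k.+1 dU} -> {subset X <= monos n k.+1 dX} ->
  (forall u i, u \in U -> wt u = e -> i < k.+1 -> incr_nth u i.+1 \in X) ->
  shadow_pair n k e (slice k e U) (slice k e.+1 X).
Proof.
move=> uU uX UT XT UX; split.
- exact: slice_uniq UT uU.
- exact: slice_uniq XT uX.
- by move=> w; rewrite (mem_slice _ _ UT) => /andP[].
- by move=> w; rewrite (mem_slice _ _ XT) => /andP[].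
have facts w : w \in monos n k e ->
    [/\ size w = k.+1, wt w <= e & wt (rcons w (e - wt w)) = e].
  rewrite mem_monos => /and3P[/eqP sw _ dw].
  by rewrite wt_rcons ?sw // subnKC.
split=> [w|w i]; rewrite (mem_slice _ _ UT) => /andP[wT wU];
  have [sw dw we] := facts w wT; last move=> ik; rewrite (mem_slice _ _ XT).
  rewrite (monos_widen (leqnSn e)) //=; have := UX _ k wU we (leqnn _).
  by rewrite -sw incr_nth_rcons_last subSn.
rewrite monos_incr //=; have := UX _ i wU we (ltnW ik).
by rewrite incr_nth_rcons ?sw // wt_incr ?sw.
Qed.

Lemma count_wt N (X : seq (seq nat)) :
  count (fun u => wt u < N) X = \sum_(e < N) count (fun u => wt u == e) X.
Proof.
elim: N => [|N IH].
  by rewrite big_ord0 -[RHS](count_pred0 X); apply: eq_count.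
rewrite big_ord_recr /= -IH -count_predUI.
rewrite [X in _ = _ + X](_ : _ = 0) ?addn0; last first.
  by rewrite -[RHS](count_pred0 X); apply: eq_count => u /=; case: ltngtP.
by apply: eq_count => u /=; rewrite ltnS leq_eqVlt orbC.
Qed.

Lemma size_slices n k d U : {subset U <= monos n k.+1 d} ->
  size U = \sum_(e < d.+1) size (slice k e U).
Proof.
move=> UT; transitivity (count (fun u => wt u < d.+1) U).
  apply/esym/eqP; rewrite -all_count; apply/allP => u /UT.
  by rewrite mem_monos => /and3P[].
by rewrite count_wt; apply: eq_bigr => e _; rewrite size_map size_filter.
Qed.

(** Above [rcons p q] there are, in every slice, all the monomials above [p]. *)
Lemma rank_slices n k d p q : size p = k.+1 ->
  \sum_(e < d.+1) rank n k e p <= rank n k.+1 d (rcons p q).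
Proof.
move=> sp.
have layer e : rank n k e p <=
    count (lexlt (rcons p q)) [seq rcons w (e - wt w) | w <- monos n k e].
  rewrite count_map; apply: sub_in_count => w.
  rewrite mem_monos => /and3P[/eqP sw _ _] /= pw.
  by rewrite lexlt_rcons ?sw // pw.
elim: d => [|d IH].
  by rewrite big_ord_recr big_ord0 /= /rank monosS /= cats0 layer.
rewrite big_ord_recr /= [leqRHS]/rank monosSS count_cat.
exact: leq_add IH (layer _).
Qed.

(** The last slice of degree [d.+1] has, above [rcons p q], the monomials above
    [p] and at most the one monomial that extends [p]. *)
Lemma rank_top n k d p q : size p = k.+1 ->
  rank n k.+1 d.+1 (rcons p q) <=
    rank n k.+1 d (rcons p q) + (rank n k d.+1 p).+1.
Proof.
move=> sp; rewrite /rank monosSS count_cat leq_add2l count_map.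
apply: leq_trans (_ : count (predU (pred1 p) (lexlt p)) (monos n k d.+1) <= _).
  apply: sub_in_count => w; rewrite mem_monos => /and3P[/eqP sw _ _] /=.
  rewrite lexlt_rcons ?sw // orbC eq_sym.
  by case/orP=> [/andP[-> _]|->]; rewrite ?orbT.
rewrite -[leqLHS](addnK (count (predI (pred1 p) (lexlt p)) (monos n k d.+1))).
rewrite count_predUI; apply: leq_trans (leq_subr _ _) _.
by rewrite -[leqRHS]add1n leq_add2r count_uniq_mem ?monos_uniq // leq_b1.
Qed.

(** By induction on the number of variables; [U] may be taken stable. If the
    shadow [W] were too small, its slice of degree [d.+1], whose size is at most
    [size W - size U], would have at most as many elements as there are monomials
    above [p]. By the induction hypothesis the same then holds for the slice of
    [U] of degree [d], and, as by stability each slice of [U] contains the shadow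
    of the previous one, for all the slices of [U]. Then [U] would be too
    small. *)
Theorem macaulay n k d U W p : shadow_pair n k d U W -> size p = k.+1 ->
  rank n k d p < size U -> rank n k d.+1 p < size W.
Proof.
elim: k d U W p => [|k IH] d U W p.
  case=> uU _ _ _ [UW _] _ /leq_trans; apply.
  exact: uniq_leq_size uU UW.
move=> /stabilise[U' [W' [UW st <- <-]]].
case/lastP: p => [|p q] //; rewrite size_rcons => -[sp] ltU.
rewrite ltnNge; apply/negP => leW.
have [uU uW UT WT [UsubW UincrW]] := UW.
have sizeW : size U' + size (slice k d.+1 W') <= size W'.
  rewrite size_map size_filter -(count_predC (fun u => wt u == d.+1) W').
  rewrite addnC leq_add2l.
  rewrite -size_filter; apply: uniq_leq_size => // u xu.
  rewrite mem_filter UsubW // andbT /=.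
  move: (UT _ xu); rewrite mem_monos => /and3P[_ _ dv].
  by rewrite neq_ltn ltnS dv.
have top : size (slice k d.+1 W') <= rank n k d.+1 p.
  by have := rank_top n d q sp; lia.
(* Downward induction on the degree [e] of the slice. *)
have low e : e <= d -> size (slice k e U') <= rank n k e p.
  move=> ed; rewrite -(subKn ed); elim: (d - e) => [|i IHi].
    rewrite subn0; apply: contraLR top; rewrite -!ltnNge; apply: IH => //.
    by apply: slice_pair UT WT _ => // u l xu _; apply: UincrW.
  have [di|id] := leqP d i; first by have -> : d - i.+1 = d - i by lia.
  have e1 : (d - i.+1).+1 = d - i by rewrite subnSK.
  apply: contraLR IHi; rewrite -!ltnNge -e1; apply: IH => //.
  apply: (slice_pair uU uU UT UT) => u l xu we lk.
  by apply: stableP st xu _ lk; rewrite we; lia.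
have : size U' <= rank n k.+1 d (rcons p q).
  rewrite (size_slices UT); apply: leq_trans (rank_slices _ _ q sp).
  by apply: leq_sum => e _; apply: low; rewrite -ltnS.
by rewrite leqNgt ltU.
Qed.

(** * Lexicographic chains from antichains *)

(** Unlike in [monos], here [b] and [w] carry all of their [k.+1] exponents. *)
Definition divides k (b w : seq nat) : bool :=
  (head 0 b == head 0 w) &&
  all (fun l => nth 0 b l.+1 <= nth 0 w l.+1) (iota 0 k.+1).

Lemma divides_refl k b : divides k b b.
Proof. by rewrite /divides eqxx; apply/allP => l _. Qed.

Lemma divides_incr k b w i : divides k b w -> divides k b (incr_nth w i.+1).
Proof.
case/andP=> /eqP e /allP le_bw; apply/andP; split.
  by rewrite e; case: w {e le_bw}.
apply/allP => l /le_bw; rewrite nth_incr_nth => /leq_trans; apply.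
exact: leq_addl.
Qed.

Definition multiples n k B d : seq (seq nat) :=
  [seq q <- monos n k d | has (fun b => divides k b (rcons q (d - wt q))) B].

Lemma multiples_pair n k B d :
  shadow_pair n k d (multiples n k B d) (multiples n k B d.+1).
Proof.
split; rewrite ?filter_uniq ?monos_uniq //.
- by move=> q; rewrite mem_filter => /andP[].
- by move=> q; rewrite mem_filter => /andP[].
have factor q q' i : q \in multiples n k B d -> q' \in monos n k d.+1 ->
    rcons q' (d.+1 - wt q') = incr_nth (rcons q (d - wt q)) i.+1 ->
    q' \in multiples n k B d.+1.
  rewrite !mem_filter => /andP[/hasP[b bB bq] qT] q'T ->.
  by rewrite q'T andbT; apply/hasP; exists b => //; apply: divides_incr.
have facts q : q \in multiples n k B d ->
    [/\ q \in monos n k d, size q = k.+1 & wt q <= d].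
  rewrite mem_filter => /andP[_ qT].
  by split=> //; move: qT; rewrite mem_monos => /and3P[/eqP].
split=> [q qJ|q i qJ ik]; have [qT sq dq] := facts q qJ.
  apply: (factor q q k) => //; first exact: (monos_widen (leqnSn d) qT).
  by rewrite -sq incr_nth_rcons_last subSn.
apply: (factor q _ i) => //; first exact: monos_incr.
by rewrite incr_nth_rcons ?sq ?ltnS // wt_incr ?sq.
Qed.

Lemma macaulay_multiples n k B d d' p : size p = k.+1 -> d <= d' ->
  rank n k d p < size (multiples n k B d) ->
  rank n k d' p < size (multiples n k B d').
Proof.
move=> sp /subnKC <-; elim: (d' - d) => [|i IH]; rewrite ?addn0 // => /IH.
by rewrite addnS; apply: macaulay sp; apply: multiples_pair.
Qed.

Lemma multiples_cons n k B b : size b = k.+2 -> head 0 b < n ->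
    {in B, forall b', ~~ divides k b' b} ->
  size (multiples n k B (wt b)) < size (multiples n k (b :: B) (wt b)).
Proof.
case/lastP: b => [|q t] //; rewrite size_rcons => -[sq].
rewrite head_rcons ?sq // => hq nB.
have wtq : wt (rcons q t) - wt q = t by rewrite wt_rcons ?sq // addKn.
have qT : q \in monos n k (wt (rcons q t)).
  by rewrite mem_monos sq eqxx hq wt_rcons ?sq // leq_addr.
rewrite !size_filter; apply: (@count_ltn _ _ _ _ q) => //=.
- by move=> w /= ->; rewrite orbT.
- by rewrite wtq divides_refl.
by rewrite wtq; apply/hasPn => b' /nB.
Qed.

Lemma rank_lt_lexlt n k d p q : rank n k d p < rank n k d q -> lexlt q p.
Proof.
apply: contraLR => nqp; rewrite -leqNgt; have [->//|npq] := eqVneq q p.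
case/orP: (lexlt_total npq) => [qp|pq]; first by rewrite qp in nqp.
by apply: sub_count => w; apply: lexlt_trans.
Qed.

Lemma rank_surj_monos n k d t : t < size (monos n k d) ->
  exists2 q, q \in monos n k d & rank n k d q = t.
Proof.
apply: rank_surj; [exact: lexltxx | exact: lexlt_trans | | exact: monos_uniq].
by move=> x y _ _; apply: lexlt_total.
Qed.

Definition lexgt x y := lexlt y x.

Lemma lexgt_trans : transitive lexgt.
Proof. by move=> y x z xy yz; apply: lexlt_trans yz xy. Qed.

Definition monomial n k (b : seq nat) := (size b == k.+2) && (head 0 b < n).

(** The invariant is that there are more multiples than monomials above the last
    element [p] of the chain. It persists in higher degrees by Macaulay's
    theorem; there the next element of the antichain is one more multiple, so
    that the monomial next after [p] exists and can be added to the chain. *)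
Lemma chain_from n k s B d p :
    all (monomial n k) s -> path leq d (map wt s) ->
    {in s & B, forall b b', ~~ divides k b' b} ->
    pairwise (fun b' b => ~~ divides k b' b) s ->
    p \in monos n k d -> rank n k d p < size (multiples n k B d) ->
  exists2 qs, path lexgt p qs & all2 (fun q b => q \in monos n k (wt b)) qs s.
Proof.
elim: s B d p => [|b s IH] B d p; first by exists [::].
move=> /= /andP[/andP[/eqP sb hb] mono_s] /andP[db path_s] nB.
move=> /andP[ns pair_s] pT rp.
have sp : size p = k.+1 by move: pT; rewrite mem_monos => /and3P[/eqP].
have nBb : {in B, forall b', ~~ divides k b' b}.
  by move=> b' b'B; apply: nB; rewrite ?mem_head.
have := multiples_cons sb hb nBb.
have := macaulay_multiples sp db rp => lt1 lt2.
have lt_rp := leq_ltn_trans lt1 lt2.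
have [|q qT rq] := @rank_surj_monos n k (wt b) (rank n k (wt b) p).+1.
  apply: leq_trans lt_rp _; rewrite size_filter; exact: count_size.
have [||||//||qs pqs fit] := IH (b :: B) (wt b) q.
- by [].
- by [].
- move=> x y xs; rewrite inE => /orP[/eqP->|yB].
    by have /allP/(_ x xs) := ns.
  by apply: nB => //; rewrite inE xs orbT.
- by [].
- by rewrite rq.
exists (q :: qs); rewrite /= ?qT // pqs andbT.
by rewrite /lexgt (@rank_lt_lexlt n k (wt b)) // rq.
Qed.

Lemma chain_of_antichain n k s :
    all (monomial n k) s -> sorted leq (map wt s) ->
    pairwise (fun b' b => ~~ divides k b' b) s ->
  exists2 qs, sorted lexgt qs & all2 (fun q b => q \in monos n k (wt b)) qs s.
Proof.
case: s => [|b s]; first by exists [::].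
move=> /= /andP[/andP[/eqP sb hb] mono_s] path_s /andP[ns pair_s].
have := @multiples_cons n k [::] b sb hb (fun _ => ltac:(by [])).
move=> lt_b.
have [|q qT rq] := @rank_surj_monos n k (wt b) 0.
  apply: leq_trans (leq_ltn_trans _ lt_b) _ => //.
  by rewrite size_filter count_size.
have [|||//|//||qs pqs fit] := @chain_from n k s [:: b] (wt b) q.
- by [].
- by [].
- by move=> x y xs; rewrite inE => /eqP->; have /allP/(_ x xs) := ns.
- by rewrite rq; apply: leq_ltn_trans lt_b.
by exists (q :: qs) => //=; rewrite qT.
Qed.

(** * The longest chains of vectors: the function Psi *)

Fixpoint fits (h : nat -> nat) i (qs : seq (seq nat)) : bool :=
  if qs is q :: qs' then (sumn q <= h i) && fits h i.+1 qs' else true.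

Lemma fits_cat h i qs1 qs2 :
  fits h i (qs1 ++ qs2) = fits h i qs1 && fits h (i + size qs1) qs2.
Proof.
by elim: qs1 i => [|q qs1 IH] i /=; rewrite ?addn0 // IH addSnnS andbA.
Qed.

Lemma fits_shift h a i qs :
  fits (fun x => h (x + a)) i qs = fits h (i + a) qs.
Proof. by elim: qs i => //= q qs IH i; rewrite IH addSn. Qed.

Lemma fits_le h h' i qs : (forall x, h x <= h' x) ->
  fits h i qs -> fits h' i qs.
Proof.
move=> hh; elim: qs i => //= q qs IH i /andP[/leq_trans-> //].
exact: IH.
Qed.

Lemma fits_nth h i qs l : fits h i qs -> l < size qs ->
  sumn (nth [::] qs l) <= h (i + l).
Proof.
elim: qs i l => //= q qs IH i [|l] /andP[qh fq]; first by rewrite addn0.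
by rewrite ltnS => /(IH _ _ fq); rewrite addSnnS.
Qed.

Lemma lexlt0 t a : lexlt t (nseq a 0) -> size t = a -> False.
Proof.
elim: a t => [|a IH] [|x t] //.
by rewrite /= lexlt_cons ltn0 /= => /andP[_ /IH h] [/h].
Qed.

(** The vector on the left is [(v, 0, ..., 0)], of size [k]: cutting off the last
    entry covers the case [k = 0], where it is empty. *)
Lemma lexlt_top q k v : size q = k -> sumn q <= v ->
  ~~ lexlt (take k (v :: nseq k 0)) q.
Proof.
case: q => [|y q] <- //= sq; rewrite lexlt_cons negb_or -leqNgt.
rewrite (leq_trans _ sq) ?leq_addr //=; apply/negP => /andP[/eqP vy].
have: sumn q = 0 by lia.
elim: q {sq} => //= z q IH /eqP; rewrite addn_eq0 => /andP[/eqP-> /eqP/IH h].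
by rewrite lexlt_cons ltnn.
Qed.

Lemma lexlt_decr s a t t' : lexlt (s ++ a :: t) (s ++ a.+1 :: t').
Proof.
by elim: s => [|x s IH]; rewrite /= lexlt_cons ?ltnSn // eqxx IH orbT.
Qed.

(** Below [s ++ a.+1 :: 0 ... 0] the entry [a.+1] or one before it must decrease;
    the largest choice is to keep [s], decrease [a.+1] by one, and put the rest of
    the weight right after it. *)
Lemma lexlt_next s a l v q :
  size q = size s + l.+1 -> sumn q <= sumn s + a + v ->
  lexlt q (s ++ a.+1 :: nseq l 0) ->
  ~~ lexlt (s ++ a :: take l (v :: nseq l 0)) q.
Proof.
elim: s q => [|x s IH] [|y q] //=.
  move=> [sq] le_v; rewrite !lexlt_cons ltnS negb_or -leqNgt.
  case/orP=> [|/andP[_ /lexlt0]]; last by move/(_ sq).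
  case: (ltngtP y a) => //= ya _.
  by apply: lexlt_top => //; lia.
move=> [sq] le_v; rewrite !lexlt_cons negb_or -leqNgt.
case: (ltngtP y x) => //= yx lt_q.
by apply: IH => //; lia.
Qed.

Definition chain qs := pairwise lexgt qs.

Definition init (u : seq nat) := take (size u).-1 u.

Lemma sumn_init u : sumn (init u) <= sumn u.
Proof.
rewrite -[X in _ <= sumn X](cat_take_drop (size u).-1) sumn_cat.
exact: leq_addr.
Qed.

Lemma all_below e q qs : ~~ lexlt e q -> all (lexgt q) qs -> all (lexgt e) qs.
Proof.
move=> nlt; have [<-//|neq] := eqVneq q e.
case/orP: (lexlt_total neq) => [lt_q|/(negP nlt)//]; apply: sub_all => q' lt_q'.
exact: lexlt_trans lt_q' lt_q.
Qed.

Lemma init_cat s a l b :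
  init (s ++ a :: rcons (nseq l 0) b) = s ++ a :: nseq l 0.
Proof.
by rewrite /init -rcons_cons -rcons_cat -cats1 size_cat addn1 take_size_cat.
Qed.

Lemma init_next s a l v :
  init (s ++ a :: v :: nseq l 0) = s ++ a :: take l (v :: nseq l 0).
Proof.
rewrite /init size_cat /= size_nseq addnS /= take_cat.
by rewrite ltnNge leq_addr addKn.
Qed.

Section Psi.

Variable h : nat -> nat.
Hypothesis h_mono : {homo h : i j / i <= j}.

Lemma sumn_next i s a l b : sumn (s ++ a.+1 :: rcons (nseq l 0) b) = h i ->
  sumn (s ++ a :: h i.+1 - h i + b + 1 :: nseq l 0) = h i.+1.
Proof.
have := h_mono (leqnSn i).
rewrite !sumn_cat /= sumn_rcons sumn_nseq mul0n; lia.
Qed.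

(** One step of the recursion for [Psi] moves to the lexicographically largest
    vector of weight at most [h i.+1] below the current one: decrease the last
    positive entry and put all the weight this frees, together with the growth
    of [h], as far left as possible. *)
Lemma Psi_next_max u i : sumn u = h i -> ~ init_zero u ->
  [/\ sumn (Psi_next h i u) = h i.+1,
      (size (Psi_next h i u)).-1 = (size u).-1,
      lexlt (init (Psi_next h i u)) (init u)
    & forall q, size q = (size u).-1 -> sumn q <= h i.+1 ->
        lexlt q (init u) -> ~~ lexlt (init (Psi_next h i u)) q].
Proof.
move=> su /negP/init_zeroPn[s [a [l [b def_u]]]].
have sum_next := sumn_next (etrans (esym (congr1 sumn def_u)) su).
have size_u : (size u).-1 = size s + l.+1.
  by rewrite def_u size_cat /= size_rcons size_nseq; lia.
rewrite size_u def_u Psi_nextE init_next init_cat; split=> // [||q sq le_q].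
- by rewrite size_cat /= size_nseq; lia.
- exact: lexlt_decr.
apply: lexlt_next => //.
by move: sum_next; rewrite sumn_cat /= sumn_nseq mul0n; lia.
Qed.

(** [Psi] counts the steps of the greedy chain, which takes each time the
    largest vector allowed; every chain stays below the greedy one, and ends no
    later. *)
Lemma Psi_upper u i qs : sumn u = h i -> chain (init u :: qs) ->
  all (fun q => size q == (size u).-1) qs -> fits h i.+1 qs ->
  i + size qs <= Psi h i u.
Proof.
elim: (lex_lt_wf u) i qs => {}u _ IH i qs su; rewrite PsiE.
case: ifP => [uz|nuz].
  case: qs => [|q qs] /=; first by rewrite addn0.
  case/andP=> /andP[+ _] _ /andP[/eqP sq _].
  have -> : init u = nseq (size u).-1 0.
    have /all_pred1P := uz; rewrite -/(init u) => ->.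
    by rewrite size_takel // leq_pred.
  by move/lexlt0/(_ sq).
have nz : ~ init_zero u by rewrite nuz.
have [sum_next size_next _ next_max] := Psi_next_max su nz.
have := IH _ (Psi_next_lt h i nz) i.+1 _ sum_next.
rewrite size_next => {}IH.
case: qs => [|q qs] /= chain_qs.
  by rewrite addn0 => _ _; have := IH [::] isT isT isT; lia.
case/andP=> /eqP sq sqs /andP[hq fqs].
case/andP: chain_qs => /andP[ltq _] /andP[ltqs chain_qs].
rewrite -addSnnS; apply: IH => //=; rewrite chain_qs andbT.
exact: all_below (next_max q sq hq ltq) ltqs.
Qed.

Lemma Psi_attained u i : sumn u = h i ->
  exists qs, [/\ chain (init u :: qs),
    all (fun q => size q == (size u).-1) qs, fits h i.+1 qs
    & i + size qs = Psi h i u].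
Proof.
elim: (lex_lt_wf u) i => {}u _ IH i su; rewrite PsiE.
case: ifP => [uz|nuz]; first by exists [::]; rewrite addn0.
have nz : ~ init_zero u by rewrite nuz.
have [sum_next size_next lt_next _] := Psi_next_max su nz.
have [qs [ch sqs fqs <-]] := IH _ (Psi_next_lt h i nz) i.+1 sum_next.
rewrite size_next in sqs.
exists (init (Psi_next h i u) :: qs); split => //=; last by rewrite addSnnS.
- move: ch => /= /andP[ltqs ->]; rewrite ltqs /lexgt lt_next !andbT /=.
  by apply: sub_all ltqs => q' lt_q'; apply: lexlt_trans lt_q' lt_next.
- by rewrite sqs size_takel ?leq_pred // size_next eqxx.
by rewrite fqs andbT -sum_next sumn_init.
Qed.

Lemma init_top k : init (h 1 :: nseq k 0) = take k (h 1 :: nseq k 0).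
Proof. by rewrite /init /= size_nseq. Qed.

Lemma sumn_top k : sumn (h 1 :: nseq k 0) = h 1.
Proof. by rewrite /= sumn_nseq mul0n addn0. Qed.

Lemma Psi_top_upper k qs : chain qs -> all (fun q => size q == k) qs ->
  fits h 1 qs -> size qs <= Psi h 1 (h 1 :: nseq k 0).
Proof.
case: qs => [|q qs] //= /andP[ltqs ch] /andP[/eqP sq sqs] /andP[hq fqs].
rewrite -add1n; apply: Psi_upper (sumn_top k) _ _ _ => //=.
  by rewrite ch andbT init_top (all_below (lexlt_top sq hq) ltqs).
by rewrite size_nseq.
Qed.

Lemma Psi_top_attained k : exists qs,
  [/\ chain qs, all (fun q => size q == k) qs,
      fits h 1 qs & size qs = Psi h 1 (h 1 :: nseq k 0)].
Proof.
have [qs [ch sqs fqs <-]] := Psi_attained (sumn_top k).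
exists (init (h 1 :: nseq k 0) :: qs); split=> //=.
  rewrite /= size_nseq in sqs; rewrite sqs andbT init_top size_take /= size_nseq.
  by rewrite ltnS leqnn.
by rewrite fqs andbT -[X in _ <= X](sumn_top k) sumn_init.
Qed.

End Psi.

(** * The longest chains in a free module: the sequence psi *)

(** The components never increase along a chain. *)
Lemma chain_split c qs : chain qs ->
  qs = [seq q <- qs | c <= head 0 q] ++ [seq q <- qs | head 0 q < c].
Proof.
elim: qs => //= q qs IH /andP[ltq /IH e].
case: (ltnP (head 0 q) c) => cq /=; last by rewrite -e.
have low : all (fun q => head 0 q < c) qs.
  apply/allP => q' /(allP ltq) {ltq}; case: q' q cq => [|x q'] [|y q] //=.
    by move=> cy _; apply: leq_ltn_trans cy.
  rewrite /lexgt lexlt_cons => cy /orP[xy|/andP[/eqP->]] //.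
  exact: ltn_trans xy cy.
suff -> : [seq q <- qs | c <= head 0 q] = [::] by rewrite (all_filterP low).
apply/eqP; rewrite -(negbK (_ == _)) -has_filter -all_predC.
by apply: sub_all low => q' /=; rewrite ltnNge.
Qed.

Section PsiIter.

Variables (n k : nat) (f : nat -> nat).
Hypothesis f_mono : {homo f : i j / i <= j}.

(** Monomials in one of the [j] components that come first in a chain. *)
Definition slot j (q : seq nat) : bool :=
  [&& size q == k.+1, n - j <= head 0 q & head 0 q < n].

Let fj j := fun x => f (x + psi f k.+1 j).

Lemma fj_mono j : {homo fj j : x y / x <= y}.
Proof. by move=> x y xy; apply: f_mono; rewrite leq_add2r. Qed.

(** The part of the chain in the first [j] components has length at most
    [psi f k.+1 j]; in the next component the chain goes on with the shifted
    function, and a shift that is too large only weakens the bound, as [f] is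
    increasing. *)
Lemma psi_upper j qs : j <= n -> chain qs -> all (slot j) qs ->
  fits f 1 (map behead qs) -> size qs <= psi f k.+1 j.
Proof.
elim: j qs => [|j IH] qs jn ch slots.
  case: qs slots {ch} => //= q qs.
  by rewrite /slot subn0; case: ltnP; rewrite ?andbF.
rewrite (chain_split (n - j) ch); set qs1 := filter _ _; set qs2 := filter _ _.
rewrite map_cat fits_cat size_map size_cat => /andP[fit1 fit2].
have le1 : size qs1 <= psi f k.+1 j.
  apply: IH fit1; [exact: ltnW | exact: pairwise_filter |].
  apply/allP => q; rewrite mem_filter => /andP[cq /(allP slots)/and3P[sq _ hq]].
  by rewrite /slot sq cq.
pose c := n - j.+1.
have qs2P q : q \in qs2 -> q = c :: behead q /\ size (behead q) = k.
  rewrite mem_filter => /andP[cq /(allP slots)/and3P[+ lo hi]].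
  case: q cq lo hi => //= x q cq lo hi; rewrite eqSS => /eqP->; split=> //.
  by congr (_ :: _); rewrite /c; lia.
rewrite /= addnC leq_add //.
rewrite -(size_map behead); apply: Psi_top_upper; first exact: (fj_mono j).
- have ch2 : chain qs2 by apply: pairwise_filter.
  rewrite /chain pairwise_map; apply: (sub_in_pairwise _ (allss qs2) ch2) => x y.
  move=> /qs2P[-> _] /qs2P[-> _]; rewrite /lexgt lexlt_cons ltnn eqxx //.
- by rewrite all_map; apply/allP => q /qs2P[_ /= ->].
move: fit2; rewrite -fits_shift; apply: fits_le => x.
by apply: f_mono; rewrite leq_add2l.
Qed.

Lemma psi_attained j : j <= n -> exists qs,
  [/\ chain qs, all (slot j) qs, fits f 1 (map behead qs)
    & size qs = psi f k.+1 j].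
Proof.
elim: j => [|j IH] jn; first by exists [::].
have [qs [ch slots fit sz]] := IH (ltnW jn).
have [es [che sze fite szes]] := Psi_top_attained (fj_mono j) k.
exists (qs ++ map (cons (n - j.+1)) es); split.
- rewrite /chain pairwise_cat [pairwise _ qs]ch /= pairwise_map.
  apply/andP; split; last first.
    by apply: sub_pairwise che => x y; rewrite /lexgt /= lexlt_cons ltnn eqxx.
  apply/allrelP => q _ /(allP slots)/and3P[sq lo hi] /mapP[e _ ->].
  case: q sq lo hi => // x q _ /= lo hi; rewrite /lexgt lexlt_cons.
  by apply/orP; left; lia.
- rewrite all_cat all_map; apply/andP; split.
    apply: sub_all slots => q /and3P[sq lo hi].
    by rewrite /slot sq hi andbT /=; lia.
  by apply: sub_all sze => e /= /eqP se; rewrite /slot /= se eqxx leqnn; lia.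
- rewrite map_cat fits_cat fit size_map sz -map_comp map_id_in //.
  by rewrite -fits_shift.
by rewrite size_cat size_map sz szes addnC.
Qed.

End PsiIter.

(** * Antichain sequences *)

Definition code m n (b : m.-tuple nat * 'I_n) : seq nat := val b.2 :: val b.1.

Lemma wt_code m n (b : m.-tuple nat * 'I_n) : wt (code b) = deg b.
Proof. by rewrite /wt /deg /= sumnE big_tuple. Qed.

Lemma divides_code k n (b c : k.+1.-tuple nat * 'I_n) :
  divides k (code b) (code c) = vec_le b c.
Proof.
rewrite /divides /vec_le; congr (_ && _).
apply/allP/forallP => [le_bc l | le_bc l].
  by rewrite !(tnth_nth 0) le_bc // mem_iota ltn_ord.
rewrite mem_iota /= => lk; have := le_bc (Ordinal lk).
by rewrite !(tnth_nth 0).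
Qed.

Lemma vec_le_anti m n (b c : m.-tuple nat * 'I_n) :
  vec_le b c -> deg c <= deg b -> vec_le c b.
Proof.
rewrite /vec_le /deg eq_sym => /andP[-> /forallP le_bc] le_deg /=.
apply/forallP => l; rewrite leqNgt; apply/negP => lt_l.
move: le_deg; rewrite leqNgt => /negP; apply.
rewrite (bigD1 l) //= [leqRHS](bigD1 l) //= -addSn leq_add //.
exact: leq_sum.
Qed.

(** The reason why sorting a sequence by degree respects the bound on its degree
    growth: only the number of members of degree at most [x] matters. *)
Lemma nth_sorted_le t x l :
  sorted leq t -> l < count (fun y => y <= x) t -> nth 0 t l <= x.
Proof.
elim: t l => // y t IH l /= yt; case: (leqP y x) => [yx|xy] /=.
  by case: l => //= l; rewrite add1n ltnS; apply: IH (path_sorted yt).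
have /allP min_y := order_path_min leq_trans yt.
suff -> : count (fun y => y <= x) t = 0 by [].
apply/eqP; rewrite eqn0Ngt -has_count; apply/hasPn => z /min_y yz.
by rewrite -ltnNge (leq_trans xy).
Qed.

Lemma fits_chain n k f i qs s :
  all2 (fun q b => q \in monos n k (wt b)) qs s ->
  (forall l, l < size s -> wt (nth [::] s l) <= f (i + l)) ->
  fits f i (map behead qs).
Proof.
elim: qs s i => [|q qs IH] [|b s] i //= /andP[qT fit] bnd.
have := bnd 0 isT; rewrite addn0 /= => b0.
move: qT; rewrite mem_monos => /and3P[_ _ /leq_trans -> //].
by apply: IH fit _ => l ls; rewrite addSnnS; apply: (bnd l.+1).
Qed.

Lemma antichain_upper k n f K : {homo f : i j / i <= j} ->
  bounded_antichain_length f k.+1 n K -> K <= psi f k.+1 n.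
Proof.
move=> f_mono [a [anti bnd]].
pose s0 := [seq code (a i) | i <- enum 'I_K].
pose leW x y := wt x <= wt y.
pose s := sort leW s0.
have mem_s x : x \in s -> exists i, x = code (a i).
  by rewrite mem_sort => /mapP[i _ ->]; exists i.
have size_s : size s = K by rewrite size_sort size_map size_enum_ord.
have uniq_s : uniq s.
  rewrite sort_uniq map_inj_uniq ?enum_uniq // => i j e.
  apply/eqP; apply: contraT => /anti; rewrite -divides_code e.
  by rewrite divides_refl.
have mono_s : all (monomial n k) s.
  apply/allP => _ /mem_s[i ->]; rewrite /monomial /= size_tuple eqxx.
  exact: ltn_ord.
have sorted_s : sorted leq (map wt s).
  rewrite sorted_map; apply: sort_sorted => x y; exact: leq_total.
have pair_s : pairwise (fun b' b => ~~ divides k b' b) s.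
  move: uniq_s; rewrite uniq_pairwise; apply: sub_in_pairwise (allss s) => x y.
  move=> /mem_s[i ->] /mem_s[j ->] /= neq; rewrite divides_code; apply: anti.
  by apply: contraNneq neq => ->.
have [qs sorted_qs fit] := chain_of_antichain mono_s sorted_s pair_s.
have size_qs : size qs = K.
  by rewrite -size_s; move: fit; rewrite all2E => /andP[/eqP].
rewrite -size_qs; apply: psi_upper (leqnn n) _ _ _ => //.
- by rewrite /chain -sorted_pairwise //; apply: lexgt_trans.
- move: qs s fit {sorted_qs size_qs mem_s size_s uniq_s mono_s sorted_s pair_s}.
  elim=> [|q qs IH] [|b s'] //=.
  case/andP=> + /IH->; rewrite mem_monos andbT /slot subnn.
  by case/and3P=> -> ->.
apply: fits_chain fit _ => l; rewrite size_s => lK.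
rewrite -(nth_map _ 0) ?size_s //; apply: nth_sorted_le => //.
rewrite count_map (permP (permEl (perm_sort _ _))) count_map.
apply: leq_trans (_ : count (fun i : 'I_K => i < l.+1) (enum 'I_K) <= _).
  rewrite -(count_map val (fun j => j < l.+1)) val_enum_ord.
  rewrite -(subnKC lK) iotaD count_cat; apply: leq_trans (leq_addr _ _).
  rewrite -[X in X <= _](size_iota 0) leq_eqVlt eq_sym -all_count.
  by apply/orP; left; apply/allP => i; rewrite mem_iota.
apply: sub_count => i /= il; rewrite wt_code.
exact: leq_trans (bnd i) (f_mono _ _ il).
Qed.

Lemma lexlt_coord (x y : seq nat) : size x = size y ->
  (forall l, l < size x -> nth 0 y l <= nth 0 x l) -> ~~ lexlt x y.
Proof.
elim: x y => [|a x IH] [|b y] //= [sxy] le_yx.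
rewrite lexlt_cons negb_or -leqNgt (le_yx 0) //=.
by rewrite negb_and IH ?orbT // => l; apply: (le_yx l.+1).
Qed.

(** Give each monomial of a longest chain the degree that the bound allows. A
    later monomial is lexicographically smaller, so that it is not a multiple of
    an earlier one; and as its degree is at least as large, it does not divide
    an earlier one either. *)
Lemma antichain_lower k n f : 0 < n -> {homo f : i j / i <= j} ->
  bounded_antichain_length f k.+1 n (psi f k.+1 n).
Proof.
case: n => // n _ f_mono.
have [qs [ch slots fit sz]] := psi_attained k f_mono (leqnn n.+1).
pose q (i : nat) := nth [::] qs i.
pose full i := rcons (behead (q i)) (f i.+1 - wt (q i)).
pose a (i : 'I_(psi f k.+1 n.+1)) : k.+1.-tuple nat * 'I_n.+1 :=
  ([tuple nth 0 (full i) l | l < k.+1], inord (head 0 (q i))).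
have qP i : i < size qs -> [/\ size (q i) = k.+1, head 0 (q i) < n.+1
    & wt (q i) <= f i.+1].
  move=> iqs; have /and3P[/eqP sq _ hq] := allP slots _ (mem_nth [::] iqs).
  split=> //; have := fits_nth fit; rewrite size_map => /(_ _ iqs).
  by rewrite (nth_map [::]).
have deg_a i : deg (a i) = f i.+1.
  have [sq _ dq] := qP i (etrans (congr1 _ sz) (ltn_ord i)).
  rewrite /deg -(subnKC dq) -[LHS]/(\sum_(l < k.+1) _).
  transitivity (sumn (full i)); last by rewrite sumn_rcons.
  rewrite sumnE (big_nth 0) size_rcons size_behead sq big_mkord.
  by apply: eq_bigr => l _; rewrite tnth_mktuple.
have no_le (i j : 'I__) : i < j -> ~~ vec_le (a i) (a j).
  move=> ij; have [iqs jqs] : i < size qs /\ j < size qs by rewrite !sz !ltn_ord.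
  have [si hi _] := qP _ iqs; have [sj hj _] := qP _ jqs.
  apply/negP => /andP[/eqP eh /forallP le_ij].
  have := pairwiseP [::] ch _ _ iqs jqs ij; apply/negP.
  apply: lexlt_coord => [|l]; rewrite -/(q i) -/(q j) ?si // sj.
  case: l => [_|l lk].
    by move/(congr1 val): eh => /=; rewrite !nth0 !inordK // => ->.
  have := le_ij (Ordinal (ltnW lk)); rewrite !tnth_mktuple /=.
  by rewrite !nth_rcons !size_behead si sj /= (lk : l < k) !nth_behead.
exists a; split=> [i j|i]; last by rewrite deg_a.
rewrite neq_ltn => /orP[|ji]; first exact: no_le.
apply: contra (no_le j i ji) => /vec_le_anti; apply; rewrite !deg_a.
exact/f_mono/ltnW.
Qed.

Theorem corollary3p14 (m n : nat) (hm : 0 < m) (hn : 0 < n) (f : nat -> nat)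
  (hf : {homo f : i j / i <= j}) :
  max_antichain_length f m n (psi f m n).
Proof.
case: m hm => // k _; split; first exact: antichain_lower.
by move=> K; apply: antichain_upper.
Qed.
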